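(* Let $\mathcal{C} = \{C_1,\ldots,C_M\}$ be a set of learners with training set $T_r$ of size $N$, validation set $T_v$, training cost functions $c_i$ and accuracy functions $f_i$ for $i \in [M]$. Let $r > 1$, $b \in \mathbb{N}^+$, and $\Delta \in (0,1]$. Let $J = \{j \mid C_j \in \mathcal{C} \text{ is } (N,\Delta)\text{-suboptimal}\}$. Suppose that for all $j \in J$, $f_j$ is well-behaved and $f'_j(N) \leq \Delta/N$, and that $f_{i^*}$ is well-behaved, where $i^* \in \arg\max_{i\in[M]} f_i(N)$. If DAUB*$(\mathcal{C}, T_r, T_v, r, b)$, run with the projected upper bound functions $\mathrm{ub}_i$, outputs $S$ as the training data allocation sequence along with a selected learner $C_{\tilde{i}}$ trained on all of $T_r$, then: 1. $\mathrm{cost}(S_{\tilde{i}}) \leq \frac{r}{r-1}\, c_{\tilde{i}}(N)$; 2. the $(N,\Delta)$-regret of $S$ is $o\left(\sum_{j \in J} c_j(N)\right)$ in $N$; and 3. if $c_j(n) = O(c_{\tilde{i}}(n))$ for all $j \in J$, then the $(N,\Delta)$-regret of $S$ is $o(M \cdot \mathrm{cost}(S_{\tilde{i}}))$ in $N$.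
   Context: Notation: $[k]=\{1,\ldots,k\}$. Each learner $C_i$ has a cost function $c_i$ with positive real values satisfying $c_i(n)\ge n$ and $c_i(m)\ge \frac{m}{n}c_i(n)$ for $m>n$, and an accuracy function $f_i$ with values in $[0,1]$ ($c_i(n)$ and $f_i(n)$ are the expected cost of training $C_i$ on $n$ random training examples and its resulting expected validation accuracy). Suboptimality: with $i^*\in\arg\max_{i} f_i(n)$, $C_j$ is $(n,\Delta)$-suboptimal if $f_{i^*}(n)-f_j(n)\ge\Delta$. Allocation sequences: a sequence $S$ of pairs $(i,n)$, meaning that $C_i$ is trained on $n$ examples; $S_i$ is the subsequence of pairs with first coordinate $i$; $\mathrm{cost}(S)=\sum_{(i,n)\in S}c_i(n)$. The $(n,\Delta)$-regret of $S$ is $\sum_{i:\,C_i \text{ is }(n,\Delta)\text{-suboptimal}}\mathrm{cost}(S_i)$. Well-behaved: $f:\mathbb{N}\to[0,1]$ is well-behaved if it is non-decreasing and its discrete derivative $n\mapsto f(n)-f(n-1)$ is non-increasing. Upper bounds: fix $s\in\mathbb{N}^+$ and let $f'_i(n)=(f_i(n)-f_i(n-s))/s$ (one-sided discrete derivative, considered where it is defined). Let $f^T_i(n)\in[0,1]$ be the training accuracy of $C_i$ on $n$ examples; it is assumed that $f^T_i$ is non-increasing in $n$ and $f^T_i(n)\ge f_i(N)$ for all $n\in[N]$. Put $\mathrm{ub}_i(n)=\min\{f^T_i(n),\; f_i(n)+(N-n)f'_i(n)\}$. Algorithm DAUB*$(\mathcal{C},T_r,T_v,r,b)$, with $br^2\le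 N$, using projected upper bound functions $u_i$ (here $u_i=\mathrm{ub}_i$) and having exact access to $f_i$ and $c_i$: start with $S$ empty. For each $i\in[M]$, append $(i,b),(i,br),(i,br^2)$ to $S$ and set $n_i=br^2$. While $\max_i n_i<N$: choose $j\in\arg\max_{i\in[M]}u_i(n_i)$ (ties broken arbitrarily), set $n_j\leftarrow\min\{\lceil r n_j\rceil,N\}$, append $(j,n_j)$ to $S$. When the loop ends, select $\tilde{i}$ with $n_{\tilde{i}}=N$ and output $C_{\tilde{i}}$ and $S$. Asymptotics ''in $N$'': the functions $f_i$, $c_i$ are fixed functions on the positive integers not depending on $N$, the quantities $M,r,b,\Delta,s$ are fixed, and $N\to\infty$.
   Formalization: Item 1 fails when the last step is cut off at N (M=1, r=2, b=1, c(n)=n, N=5: cost 12 > 10); it is stated only for N among the sizes b, ⌈rb⌉, ⌈r⌈rb⌉⌉, ..., and with constant 1 + r/(r-1) for every other N. *)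

(* Defs.v *)
From mathcomp Require Import all_boot all_order all_algebra.
From mathcomp Require Import all_classical all_reals all_analysis.
Export numFieldNormedType.Exports.

Set Implicit Arguments.
Unset Strict Implicit.
Unset Printing Implicit Defensive.

Import Order.TTheory GRing.Theory Num.Theory.
Local Open Scope ring_scope.

(* Cost and accuracy functions are functions on the positive integers: their
   value at 0 is never constrained, and never used. *)

Definition cost_function (R : realType) (c : nat -> R) : Prop :=
  [/\ forall n, (0 < n)%N -> 0 < c n,
      forall n, (0 < n)%N -> n%:R <= c n
    & forall m n, (0 < n < m)%N -> m%:R / n%:R * c n <= c m].

Definition accuracy_function (R : realType) (f : nat -> R) : Prop :=
  forall n, (0 < n)%N -> 0 <= f n <= 1.

Definition well_behaved (R : realType) (f : nat -> R) : Prop :=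
  (forall m n, (0 < m <= n)%N -> f m <= f n) /\
  (forall m n, (1 < m <= n)%N -> f n - f n.-1 <= f m - f m.-1).

Definition is_argmax (R : realType) (M : nat) (g : 'I_M -> R) (i : 'I_M) : bool :=
  [forall k, g k <= g i].

Definition suboptimal (R : realType) (M : nat) (f : 'I_M -> nat -> R)
    (n : nat) (Delta : R) : {set 'I_M} :=
  [set j | [exists i, is_argmax (f^~ n) i && (Delta <= f i n - f j n)]].

Definition suballoc (M : nat) (S : seq ('I_M * nat)) (i : 'I_M) :
    seq ('I_M * nat) :=
  [seq p <- S | p.1 == i].

Definition cost (R : realType) (M : nat) (c : 'I_M -> nat -> R)
    (S : seq ('I_M * nat)) : R :=
  \sum_(p <- S) c p.1 p.2.

Definition regret (R : realType) (M : nat) (c f : 'I_M -> nat -> R)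
    (n : nat) (Delta : R) (S : seq ('I_M * nat)) : R :=
  \sum_(i in suboptimal f n Delta) cost c (suballoc S i).

(* Meaningful when [s < n]. *)
Definition slope (R : realType) (s : nat) (f : nat -> R) (n : nat) : R :=
  (f n - f (n - s)%N) / s%:R.

Definition training_accuracy (R : realType) (M : nat) (f : 'I_M -> nat -> R)
    (N : nat) (fT : 'I_M -> nat -> R) : Prop :=
  forall i,
    [/\ forall n, (0 < n <= N)%N -> 0 <= fT i n <= 1,
        forall m n, (0 < m <= n)%N -> (n <= N)%N -> fT i n <= fT i m
      & forall n, (0 < n <= N)%N -> f i N <= fT i n].

(* Where the slope is undefined ([n <= s], the function being defined on
   positive integers only), only the first of the two bounds is available. *)
Definition ub (R : realType) (M : nat) (s : nat) (f fT : 'I_M -> nat -> R)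
    (N : nat) (i : 'I_M) (n : nat) : R :=
  if (s < n)%N then
    Num.min (fT i n) (f i n + (N%:R - n%:R) * slope s (f i) n)
  else fT i n.

(* ceil (r n); for [r > 1] the ceiling is positive, so `|_| loses nothing. *)
Definition next_size (R : realType) (r : R) (n : nat) : nat :=
  `|Num.ceil (r * n%:R)|%N.

(* The sizes b, ceil (r b), ceil (r (ceil (r b))), ...  For [k = 0, 1, 2] they
   are the bootstrap sizes b, b r, b r^2 as soon as b r and b r^2 are integers
   (see [grid_bootstrap]); otherwise they are b r, b r^2 rounded in the way in
   which the main loop rounds. *)
Definition grid (R : realType) (r : R) (b k : nat) : nat :=
  iter k (next_size r) b.

Lemma grid_bootstrap (R : realType) (r : R) (b n1 n2 : nat) :
  b%:R * r = n1%:R -> b%:R * r ^+ 2 = n2%:R ->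
  [/\ grid r b 0 = b, grid r b 1 = n1 & grid r b 2 = n2].
Proof.
move=> h1 h2; have e1 : next_size r b = n1.
  by rewrite /next_size mulrC h1 pmulrn intrKceil.
by split=> //=; rewrite /grid /= e1 /next_size -h1 mulrCA -expr2 h2 pmulrn
  intrKceil.
Qed.

(* [daub_reach r b N u n S]: the algorithm, with projected upper bounds [u], can
   be in the state where learner [i] was last trained on [n i] examples and the
   allocation sequence is [S]. Ties in the argmax make this a relation. *)
Inductive daub_reach (R : realType) (M : nat) (r : R) (b N : nat)
    (u : 'I_M -> nat -> R) : {ffun 'I_M -> nat} -> seq ('I_M * nat) -> Prop :=
| daub_init :
    daub_reach r b N u
      [ffun=> grid r b 2]
      (flatten [seq [:: (i, grid r b 0); (i, grid r b 1); (i, grid r b 2)]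
               | i <- enum 'I_M])
| daub_step (n : {ffun 'I_M -> nat}) (S : seq ('I_M * nat)) (j : 'I_M) :
    daub_reach r b N u n S ->
    (\max_(i < M) n i < N)%N ->
    is_argmax (fun i => u i (n i)) j ->
    daub_reach r b N u
      [ffun i => if i == j then minn (next_size r (n j)) N else n i]
      (rcons S (j, minn (next_size r (n j)) N)).

Definition daub_outputs (R : realType) (M : nat) (r : R) (b N : nat)
    (u : 'I_M -> nat -> R) (S : seq ('I_M * nat)) (itil : 'I_M) : Prop :=
  (grid r b 2 <= N)%N /\
  exists n : {ffun 'I_M -> nat},
    [/\ daub_reach r b N u n S, ~~ (\max_(i < M) n i < N)%N & n itil = N].

Definition daub_run (R : realType) (M : nat) (f : 'I_M -> nat -> R)
    (r Delta : R) (b s N : nat) (fT : 'I_M -> nat -> R)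
    (S : seq ('I_M * nat)) (itil : 'I_M) : Prop :=
  [/\ training_accuracy f N fT,
      forall j, j \in suboptimal f N Delta ->
        well_behaved (f j) /\ slope s (f j) N <= Delta / N%:R,
      exists2 istar, is_argmax (f^~ N) istar & well_behaved (f istar)
    & daub_outputs r b N (ub s f fT N) S itil].

(* Main.v *)
(* Since consecutive grid sizes grow by a factor at least r and costs grow at
   least linearly, the allocations of a learner form a geometric series dominated
   by its last cost c (n i), up to the factor r / (r - 1); a last step truncated
   at N is not part of that series and adds one more c (n i).

   A suboptimal learner j is only chosen while its projected upper bound is at
   least f istar N >= f j N + Delta, because the bound of istar never falls below
   f istar N by concavity. As f j is concave and bounded, its slope at n is
   o(1/n), so for every fixed delta > 0 and N large this fails as soon as
   n >= delta N. Hence the last size of j is o(N), and by superlinearity of c j its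
   total cost is o(c j N). *)

Require Import Defs.
From mathcomp Require Import all_boot all_order all_algebra.
From mathcomp Require Import all_classical all_reals all_analysis.
From mathcomp Require Import ring lra zify.

Set Implicit Arguments.
Unset Strict Implicit.
Unset Printing Implicit Defensive.

Import Order.TTheory GRing.Theory Num.Theory.
Local Open Scope classical_set_scope.
Local Open Scope ring_scope.

(** * Discrete concavity and projected upper bounds *)

Lemma well_behaved_chord_le (R : realType) (f : nat -> R) (m k p : nat) :
  well_behaved f -> (1 < p <= m.+1)%N ->
  f (m + k)%N - f m <= k%:R * (f p - f p.-1).
Proof.
move=> [_ dec] hp; elim: k => [|k IH]; first by rewrite addn0 subrr mul0r.
have /= := dec p (m + k).+1 ltac:(lia).
rewrite addnS -natr1; lra.
Qed.

Lemma well_behaved_chord_ge (R : realType) (f : nat -> R) (m k p : nat) :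
  well_behaved f -> (0 < m)%N -> (m + k <= p)%N ->
  k%:R * (f p - f p.-1) <= f (m + k)%N - f m.
Proof.
move=> [_ dec] m0; elim: k => [|k IH] hp; first by rewrite addn0 subrr mul0r.
have /= := dec (m + k).+1 p ltac:(lia).
have := IH ltac:(lia); rewrite addnS -natr1; lra.
Qed.

(** The slope averages increments at indices up to [n], hence is at least the increment at [n],
    which by concavity dominates each of the [N - n] later ones. *)
Lemma ub_ge (R : realType) (M s N n : nat) (f fT : 'I_M -> nat -> R) (i : 'I_M) :
  (0 < s)%N -> training_accuracy f N fT -> well_behaved (f i) ->
  (0 < n <= N)%N -> f i N <= ub s f fT N i n.
Proof.
move=> s0 /(_ i)[_ _ hT] wb hn; rewrite /ub; case: ifP => sn; last exact: hT.
rewrite le_min hT //=.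
have s0R : 0 < s%:R :> R by rewrite ltr0n.
have slope_ge : f i n - f i n.-1 <= slope s (f i) n.
  rewrite /slope ler_pdivlMr// mulrC.
  have := @well_behaved_chord_ge _ (f i) (n - s) s n wb ltac:(lia) ltac:(lia).
  by rewrite subnK // ltnW.
have := @well_behaved_chord_le _ (f i) n (N - n) n wb ltac:(lia).
rewrite subnKC ?natrB; [|lia..].
have : n%:R <= N%:R :> R by rewrite ler_nat; lia.
by nra.
Qed.

(** Provides an index, independent of [N], after which [f] can gain less than [eta] in total. *)
Lemma accuracy_near_sup (R : realType) (f : nat -> R) (eta : R) :
  accuracy_function f -> 0 < eta ->
  exists2 m, (0 < m)%N & forall n, (0 < n)%N -> f n < f m + eta.
Proof.
move=> acc eta0.
pose A := f @` [set n | (0 < n)%N].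
have supA : has_sup A.
  split; first by exists (f 1%N), 1%N.
  by exists 1 => _ [n n0 <-]; have /andP[] := acc n n0.
have [_ [m m0 <-] hm] := sup_adherent eta0 supA.
exists m => // n n0.
have : f n <= sup A by apply: ub_le_sup; [case: supA | exists n].
by lra.
Qed.

Lemma slope_small (R : realType) (f : nat -> R) (s : nat) (delta Delta : R) :
  well_behaved f -> accuracy_function f -> (0 < s)%N ->
  0 < delta -> 0 < Delta ->
  \forall N \near \oo, forall n, delta * N%:R <= n%:R -> (n <= N)%N ->
    (s < n)%N /\ (N%:R - n%:R) * slope s f n < Delta.
Proof.
move=> wb acc s0 d0 D0.
(* With this [eta], [n * d <= 2 * (p - m) * d < delta * Delta], and [delta * N <= n] then gives
   [N * d < Delta]. *)
have eta0 : 0 < delta * Delta / 2 by rewrite divr_gt0 ?mulr_gt0.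
have [m m0 hm] := accuracy_near_sup acc eta0.
have s0R : 0 < s%:R :> R by rewrite ltr0n.
near=> N => n hn nN.
(* This size makes [p - m] at least half of [n]. *)
have n_large : (2 * (s + m) < n)%N.
  rewrite -(ltr_nat R); apply: lt_le_trans hn; rewrite -ltr_pdivrMl//.
  by near: N; exact: nbhs_infty_gtr.
have sn : (s < n)%N by lia.
split=> //.
(* Concavity between m and p makes (p - m) d less than delta Delta / 2, the
   total increase left after m, while n <= 2 (p - m). *)
set p := (n - s).+1; set d := f p - f p.-1.
(* [p] is the first index in the window of [s] increments averaged by the slope, so its increment is
   the largest. *)
have slope_le : slope s f n <= d.
  rewrite /slope ler_pdivrMr// mulrC.
  have := @well_behaved_chord_le _ f (n - s) s p wb ltac:(rewrite /p; lia).
  by rewrite subnK // ltnW.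
have := @well_behaved_chord_ge _ f m (p - m) p wb m0 ltac:(rewrite /p; lia).
rewrite -/d subnKC ?natrB; [|rewrite /p; lia..].
have := hm p isT.
have : n%:R <= 2 * (p%:R - m%:R) :> R.
  rewrite -natrB; last by rewrite /p; lia.
  by rewrite -natrM ler_nat /p; lia.
have d_ge0 : 0 <= d by rewrite subr_ge0; apply: wb.1; rewrite /p; lia.
have nN' : n%:R <= N%:R :> R by rewrite ler_nat.
have n0R : 0 < n%:R :> R by rewrite ltr0n; lia.
move=> h1 h2 h3.
have nd : n%:R * d < delta * Delta by nra.
have Nd : N%:R * d < Delta.
  rewrite -(ltr_pM2l d0) mulrA; apply: le_lt_trans nd.
  by rewrite ler_wpM2r.
apply: le_lt_trans Nd; apply: (@le_trans _ _ ((N%:R - n%:R) * d)).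
  by rewrite ler_wpM2l // subr_ge0.
by rewrite ler_wpM2r // gerBl ltW.
Unshelve. all: by end_near. Qed.

(** * Rounded grid sizes *)

Lemma next_sizeE (R : realType) (r : R) (n : nat) :
  0 <= r -> (next_size r n)%:R = (Num.ceil (r * n%:R))%:~R :> R.
Proof.
move=> r0; have : 0 <= Num.ceil (r * n%:R).
  by rewrite ceil_ge0 (lt_le_trans _ (mulr_ge0 r0 _)) ?ltrN10.
by rewrite /next_size; case: Num.ceil.
Qed.

Lemma next_size_ge (R : realType) (r : R) (n : nat) :
  0 <= r -> r * n%:R <= (next_size r n)%:R.
Proof. by move=> r0; rewrite next_sizeE // ceil_ge. Qed.

Lemma next_size_lt (R : realType) (r : R) (n : nat) :
  0 <= r -> (next_size r n)%:R < r * n%:R + 1.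
Proof.
by move=> r0; have := ceilB1_lt (r * n%:R); rewrite next_sizeE // intrB ltrBlDr.
Qed.

Lemma ltn_next_size (R : realType) (r : R) (n : nat) :
  1 < r -> (0 < n)%N -> (n < next_size r n)%N.
Proof.
move=> r1 n0; rewrite -(ltr_nat R).
apply: lt_le_trans (next_size_ge n (ltW (lt_trans ltr01 r1))).
by rewrite ltr_pMl // ltr0n.
Qed.

Lemma grid_gt0 (R : realType) (r : R) (b k : nat) :
  1 < r -> (0 < b)%N -> (0 < grid r b k)%N.
Proof.
move=> r1 b0; elim: k => [//|k IH].
by rewrite /grid iterS (ltn_trans IH) ?ltn_next_size.
Qed.

Lemma ltn_grid (R : realType) (r : R) (b : nat) :
  1 < r -> (0 < b)%N -> {homo grid r b : k l / (k < l)%N}.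
Proof.
move=> r1 b0; apply: homo_ltn; first exact: ltn_trans.
by move=> k; rewrite /grid iterS ltn_next_size // grid_gt0.
Qed.

(** * Consequences of superlinear cost *)

Lemma cost_function_ratio (R : realType) (c : nat -> R) (m n : nat) :
  cost_function c -> (0 < m <= n)%N -> c m <= m%:R / n%:R * c n.
Proof.
move=> [_ _ hc] /andP[m0 mn].
have n0 := leq_trans m0 mn.
have [->|neq] := eqVneq m n; first by rewrite divff ?mul1r // pnatr_eq0 -lt0n.
rewrite -ler_pdivrMl ?divr_gt0 ?ltr0n// invf_div hc//.
by rewrite m0 ltn_neqAle neq.
Qed.

Lemma cost_function_le (R : realType) (c : nat -> R) (m n : nat) :
  cost_function c -> (0 < m <= n)%N -> c m <= c n.
Proof.
move=> hc mn; apply: le_trans (cost_function_ratio hc mn) _.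
have n0 : (0 < n)%N by lia.
have cn_ge0 : 0 <= c n by case: hc => + _ _ => /(_ n n0)/ltW.
by rewrite ler_piMl // ler_pdivrMr ?ltr0n// mul1r ler_nat; lia.
Qed.

Lemma cost_function_next_size (R : realType) (c : nat -> R) (r : R) (n : nat) :
  cost_function c -> 1 < r -> (0 < n)%N -> r * c n <= c (next_size r n).
Proof.
move=> hc r1 n0; have [cpos _ hratio] := hc.
apply: le_trans (hratio _ n _); last by rewrite n0 ltn_next_size.
rewrite ler_pM2r ?cpos// ler_pdivlMr ?ltr0n//.
by apply: next_size_ge; rewrite ltW // (lt_trans ltr01).
Qed.

(** * Costs and sizes along a run *)

Lemma cost_suballoc_rcons (R : realType) (M : nat) (c : 'I_M -> nat -> R)
    (S : seq ('I_M * nat)) (j i : 'I_M) (m : nat) :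
  cost c (suballoc (rcons S (j, m)) i) =
  cost c (suballoc S i) + (if j == i then c j m else 0).
Proof.
rewrite /cost /suballoc !big_filter -cats1 big_cat big_cons big_nil /=.
by case: ifP; rewrite ?addr0.
Qed.

Lemma cost_suballoc_init (R : realType) (M : nat) (c : 'I_M -> nat -> R)
    (i : 'I_M) (m0 m1 m2 : nat) :
  cost c (suballoc (flatten [seq [:: (i, m0); (i, m1); (i, m2)]
                            | i <- enum 'I_M]) i) = c i m0 + c i m1 + c i m2.
Proof.
rewrite /cost /suballoc big_filter big_flatten big_map big_enum /=.
rewrite (bigD1 i) //= [X in _ + X]big1 ?addr0 => [|k ki].
  by rewrite !big_cons big_nil /= eqxx addr0 addrA.
by rewrite !big_cons big_nil /= (negbTE ki).
Qed.

(** The strict sandwich in the truncated case later rules that case out when [N] is itself a grid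
    size. *)
Lemma daub_reach_inv (R : realType) (M : nat) (r : R) (b N : nat)
    (c u : 'I_M -> nat -> R) (n : {ffun 'I_M -> nat}) (S : seq ('I_M * nat))
    (i : 'I_M) :
  (forall i, cost_function (c i)) -> 1 < r -> (0 < b)%N ->
  (grid r b 2 <= N)%N -> daub_reach r b N u n S ->
  [/\ (0 < n i <= N)%N,
      c i (n i) <= cost c (suballoc S i)
    & (exists k, n i = grid r b k) /\
        cost c (suballoc S i) <= r / (r - 1) * c i (n i) \/
      (exists k, grid r b k < n i < grid r b k.+1)%N /\ n i = N /\
        cost c (suballoc S i) <= (1 + r / (r - 1)) * c i (n i)].
Proof.
move=> hc r1 b0 g2N; have r0 : 0 < r by rewrite (lt_trans ltr01).
have rB1_gt0 : 0 < r - 1 by rewrite subr_gt0.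
have c_gt0 m : (0 < m)%N -> 0 < c i m by case: (hc i) => + _ _; apply.
set q := r / (r - 1).
have q_ge0 : 0 <= q by rewrite divr_ge0 ?ltW.
(* [q] solves [q = q / r + 1]: a past cost of at most [q * x] plus a new cost [y >= r * x] is again
   at most [q * y]. *)
have geom x y : 0 < x -> r * x <= y -> q * x + y <= q * y.
  move=> x0 xy; have -> : q * y = q * (y / r) + y.
    by rewrite /q; field; rewrite !gt_eqF.
  by rewrite lerD2r ler_wpM2l // ler_pdivlMr // mulrC.
have step k : r * c i (grid r b k) <= c i (grid r b k.+1).
  by rewrite {2}/grid iterS cost_function_next_size // grid_gt0.
have g0 k : 0 < c i (grid r b k) by rewrite c_gt0 // grid_gt0.
elim=> [|{}n {}S j _ [niN cle inv] nN _].
  rewrite cost_suballoc_init ffunE grid_gt0 // g2N; split=> //.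
    by rewrite lerDr addr_ge0 ?ltW.
  left; split; first by exists 2%N.
  (* [1 <= q] starts the series at [grid r b 0]; two uses of [geom] add the other bootstrap
     sizes. *)
  have q1 : 1 <= q by rewrite ler_pdivlMr // mul1r gerBl.
  apply: le_trans (geom _ _ (g0 _) (step 1%N)); rewrite lerD2r.
  apply: le_trans (geom _ _ (g0 _) (step 0%N)); rewrite lerD2r.
  by rewrite ler_peMl // ltW.
have {nN} nltN : (n i < N)%N by apply: leq_ltn_trans nN; exact: leq_bigmax.
rewrite cost_suballoc_rcons ffunE eq_sym; case: eqP => [->{j}|_]; last first.
  by rewrite addr0.
(* After a truncated step the size is [N], and the loop guard excludes another step. *)
case: inv => [[[k nik] costle]|[_ [niN' _]]]; last by rewrite niN' ltnn in nltN.
have nextE : next_size r (n i) = grid r b k.+1 by rewrite nik /grid iterS.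
have lt_grid : (grid r b k < grid r b k.+1)%N by exact: ltn_grid.
rewrite nextE; split.
- by rewrite geq_minr leq_min grid_gt0 //; lia.
- by rewrite lerDr; apply: le_trans cle; rewrite ltW // c_gt0; case/andP: niN.
rewrite nik in costle nltN.
case: leqP => gN; [left|right].
  split; first by exists k.+1.
  by apply: le_trans (geom _ _ (g0 _) (step k)); rewrite lerD2r.
split; first by exists k; rewrite nltN.
(* Here [N] is less than [r] times the previous size, so [geom] does not apply; monotonicity bounds
   the past cost by [q * c i N]. *)
split=> //; rewrite mulrDl mul1r addrC lerD2l; apply: le_trans costle _.
by rewrite ler_wpM2l // cost_function_le // grid_gt0 // ltnW.
Qed.

(** A size changes only when its learner is chosen, so the last one is a bootstrap size or at most
    one rounded step above a size bounded by [x]. *)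
Lemma daub_size_le (R : realType) (M : nat) (r x : R) (b N : nat)
    (u : 'I_M -> nat -> R) (j : 'I_M) (n : {ffun 'I_M -> nat})
    (S : seq ('I_M * nat)) :
  1 < r ->
  (forall (n : {ffun 'I_M -> nat}) S, daub_reach r b N u n S ->
     (n j < N)%N -> is_argmax (fun i => u i (n i)) j -> (n j)%:R <= x) ->
  daub_reach r b N u n S ->
  (n j)%:R <= Num.max (grid r b 2)%:R (r * x + 1).
Proof.
move=> r1 small; have r0 : 0 < r by rewrite (lt_trans ltr01).
elim=> [|{}n {}S i reach IH nN amax]; first by rewrite ffunE le_max lexx.
rewrite ffunE; case: eqP => [ji|//]; rewrite -ji in amax *.
have nj : (n j)%:R <= x.
  by apply: small reach _ amax; apply: leq_ltn_trans nN; exact: leq_bigmax.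
rewrite le_max; apply/orP; right.
apply: (@le_trans _ _ (next_size r (n j))%:R); first by rewrite ler_nat geq_minl.
apply: le_trans (ltW (next_size_lt _ (ltW r0))) _.
by rewrite lerD2r ler_wpM2l // ltW.
Qed.

(** * Vanishing relative cost of suboptimal learners *)

Lemma ub_lt (R : realType) (M s N n : nat) (f fT : 'I_M -> nat -> R)
    (i : 'I_M) (Delta : R) :
  well_behaved (f i) -> (0 < s < n)%N -> (n <= N)%N ->
  (N%:R - n%:R) * slope s (f i) n < Delta ->
  ub s f fT N i n < f i N + Delta.
Proof.
move=> wb /andP[s0 sn] nN lt_Delta; rewrite /ub sn gt_min; apply/orP; right.
by rewrite ler_ltD // wb.1 //; lia.
Qed.

Lemma suboptimal_cost_small (R : realType) (M : nat) (c f : 'I_M -> nat -> R)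
    (r Delta eps : R) (b s : nat) (j : 'I_M) :
  (forall i, cost_function (c i)) -> accuracy_function (f j) ->
  1 < r -> (0 < b)%N -> (0 < s)%N -> 0 < Delta -> 0 < eps ->
  \forall N \near \oo, forall fT S itil, daub_run f r Delta b s N fT S itil ->
    j \in suboptimal f N Delta ->
    cost c (suballoc S j) <= eps * c j N.
Proof.
move=> hc acc r1 b0 s0 D0 eps0.
(* A run requires suboptimal learners to be well-behaved, so otherwise the claim is vacuous. *)
have [wb|nwb] := pselect (well_behaved (f j)); last first.
  by near=> N => fT S itil [_ + _ _] jJ => /(_ j jJ)[].
have r0 : 0 < r by rewrite (lt_trans ltr01).
pose K := 1 + r / (r - 1).
have q_ge0 : 0 <= r / (r - 1) by rewrite divr_ge0 ?subr_ge0 ?ltW.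
have K0 : 0 < K by rewrite /K ltr_wpDr.
(* A last choice at size at most [delta * N] leads to at most
   [r * delta * N + 1 = eps / K * N / 2 + 1]; [K] is the worst cost factor, with truncation. *)
pose delta := eps / K / (2 * r).
have delta0 : 0 < delta by rewrite !divr_gt0 // mulr_gt0.
near=> N => fT S itil [hT _ [istar amax wbstar] [g2N [n [reach _ _]]]] jJ.
have N0 : (0 < N)%N by apply: leq_trans g2N; rewrite grid_gt0.
have /(_ _)/= slow : forall m, delta * N%:R <= m%:R -> (m <= N)%N ->
    (s < m)%N /\ (N%:R - m%:R) * slope s (f j) m < Delta.
  by near: N; exact: slope_small.
(* The maximiser witnessing suboptimality may differ from the well-behaved [istar], but both have
   the same accuracy at [N]. *)
have gap : f j N + Delta <= f istar N.
  move: jJ; rewrite inE => /existsP[i /andP[_ gap]].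
  have /forallP/(_ i) := amax; lra.
have {}slow (n' : {ffun 'I_M -> nat}) S' :
    daub_reach r b N (ub s f fT N) n' S' -> (n' j < N)%N ->
    is_argmax (fun i => ub s f fT N i (n' i)) j -> (n' j)%:R <= delta * N%:R.
  move=> reach' njN /forallP/(_ istar) ubmax; rewrite leNgt; apply/negP => large.
  have [sn lt_Delta] := slow _ (ltW large) (ltnW njN).
  have [/(ub_ge s0 hT wbstar) ubstar _ _] := daub_reach_inv istar hc r1 b0 g2N reach'.
  have s_itv : (0 < s < n' j)%N by rewrite s0 sn.
  have /(_ fT) := ub_lt _ wb s_itv (ltnW njN) lt_Delta.
  by rewrite ltNge (le_trans gap) // (le_trans ubstar).
have [nj _ inv] := daub_reach_inv j hc r1 b0 g2N reach.
have cn0 : 0 <= c j (n j) by case: (hc j) => /(_ (n j)) + _ _; case/andP: nj => -> _ /(_ isT)/ltW.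
have cN0 : 0 <= c j N by case: (hc j) => /(_ N N0)/ltW.
have costle : cost c (suballoc S j) <= K * c j (n j).
  case: inv => [[_ le]|[_ [_ //]]]; apply: le_trans le _.
  by rewrite ler_wpM2r // lerDr.
have nle : (n j)%:R <= eps / K * N%:R.
  apply: le_trans (daub_size_le r1 slow reach) _; rewrite ge_max; apply/andP; split.
    rewrite -ler_pdivrMl ?divr_gt0//; near: N; exact: nbhs_infty_ger.
  have -> : r * (delta * N%:R) = eps / K * N%:R / 2.
    by rewrite /delta; field; rewrite !gt_eqF.
  have : 2 <= eps / K * N%:R.
    rewrite -ler_pdivrMl ?divr_gt0//; near: N; exact: nbhs_infty_ger.
  lra.
apply: le_trans costle _; rewrite mulrC -ler_pdivlMr //.
apply: le_trans (cost_function_ratio (hc j) nj) _.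
by rewrite [leRHS]mulrAC ler_wpM2r // ler_pdivrMr ?ltr0n //.
Unshelve. all: by end_near. Qed.

(** Suboptimal and selected learners vary with [N], while a big-O constant belongs to one pair.
    There are finitely many pairs, so a sum of constants and a common threshold serve all. *)
Lemma bigO_uniform_bound (R : realType) (I : finType) (g : I -> nat -> R) :
  exists2 C, 0 < C & \forall N \near \oo, forall i j, g j =O_\oo g i ->
    `|g j N| <= C * `|g i N|.
Proof.
have pair_bound (p : I * I) : exists C, 0 < C /\
    \forall N \near \oo, g p.2 =O_\oo g p.1 -> `|g p.2 N| <= C * `|g p.1 N|.
  have [/eqO_exP[C C0 bound]|nO] := pselect (g p.2 =O_\oo g p.1).
    by exists C; split=> //; apply: filterS bound.
  by exists 1; split=> //; near=> N => /nO.
have [C HC] := choice pair_bound.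
(* The summand 1 keeps the constant positive when [I] is empty. *)
exists (1 + \sum_p C p).
  by rewrite ltr_pwDl // sumr_ge0 // => p _; case: (HC p) => /ltW.
have : \forall N \near \oo, forall p : I * I, g p.2 =O_\oo g p.1 ->
    `|g p.2 N| <= C p * `|g p.1 N|.
  by apply: filter_forall => p; case: (HC p).
apply: filterS => N bound i j /(bound (i, j))/le_trans; apply.
rewrite ler_wpM2r // (bigD1 (i, j)) //= addrCA lerDl addr_ge0 //.
by rewrite sumr_ge0 // => p _; case: (HC p) => /ltW.
Unshelve. all: by end_near. Qed.

(** Ties, training accuracies and the selected learner may change with [N], so the asymptotic claims
    range over families of runs indexed by [N]. The extra 1 in the second cost bound pays for a
    truncated last step. *)
Theorem theorem3 (R : realType) (M : nat) (c f : 'I_M -> nat -> R)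
    (r Delta : R) (b s : nat)
    (hc : forall i, cost_function (c i))
    (hf : forall i, accuracy_function (f i))
    (hr : 1 < r) (hb : (0 < b)%N) (hs : (0 < s)%N)
    (hDelta : 0 < Delta <= 1) :
  (forall (N : nat) (fT : 'I_M -> nat -> R) (S : seq ('I_M * nat))
      (itil : 'I_M),
    daub_run f r Delta b s N fT S itil ->
    ((exists k, N = grid r b k) ->
       cost c (suballoc S itil) <= r / (r - 1) * c itil N) /\
    cost c (suballoc S itil) <= (1 + r / (r - 1)) * c itil N) /\
  (forall (fT : nat -> 'I_M -> nat -> R) (S : nat -> seq ('I_M * nat))
      (itil : nat -> 'I_M),
    (\forall N \near \oo, daub_run f r Delta b s N (fT N) (S N) (itil N)) ->
    (fun N => regret c f N Delta (S N))
      =o_\oo (fun N => \sum_(j in suboptimal f N Delta) c j N) /\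
    ((\forall N \near \oo, forall j, j \in suboptimal f N Delta ->
        c j =O_\oo c (itil N)) ->
     (fun N => regret c f N Delta (S N))
       =o_\oo (fun N => M%:R * cost c (suballoc (S N) (itil N))))).
Proof.
have c_ge0 i n : (0 < n)%N -> 0 <= c i n.
  by move=> n0; case: (hc i) => /(_ n n0)/ltW.
split=> [N fT S i [_ _ _ [g2N [n [reach _ niN]]]]|fT S itil run].
  have [/andP[ni_gt0 _] _] := daub_reach_inv i hc hr hb g2N reach.
  rewrite niN in ni_gt0 * => -[[_ le]|[[k kN] [_ le]]]; split=> //.
    by apply: le_trans le _; rewrite ler_wpM2r ?c_ge0 // lerDr.
  (* No grid size lies strictly between two consecutive ones. *)
  move=> [l Nl]; have grid_mono := leqW_mono (leq_mono (ltn_grid hr hb)).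
  by move: kN; rewrite Nl !grid_mono ltnS; lia.
have cost_ge N i : daub_run f r Delta b s N (fT N) (S N) (itil N) ->
    0 <= cost c (suballoc (S N) i).
  move=> [_ _ _ [g2N [n [reach _ _]]]].
  have [/andP[ni_gt0 _] + _] := daub_reach_inv i hc hr hb g2N reach.
  by apply: le_trans; rewrite c_ge0.
have regret_small eps : 0 < eps -> \forall N \near \oo,
    `|regret c f N Delta (S N)| <=
      eps * \sum_(j in suboptimal f N Delta) c j N.
  move=> eps0; have /andP[D0 _] := hDelta.
  have small : \forall N \near \oo, forall j fT S itil,
      daub_run f r Delta b s N fT S itil -> j \in suboptimal f N Delta ->
      cost c (suballoc S j) <= eps * c j N.
    by apply: filter_forall => j; exact: suboptimal_cost_small.
  near=> N; have runN : daub_run f r Delta b s N (fT N) (S N) (itil N).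
    by near: N.
  rewrite ger0_norm; last by apply: sumr_ge0 => j _; exact: cost_ge runN.
  rewrite mulr_sumr; apply: ler_sum => j jJ.
  by move: jJ; apply: (near small N) runN.
split=> [|domO]; apply/eqoP => eps eps0.
  apply: filterS (regret_small eps eps0) => N /le_trans; apply.
  by rewrite ler_wpM2l ?ler_norm ?ltW.
have [C C0 bound] := bigO_uniform_bound c.
near=> N; have runN : daub_run f r Delta b s N (fT N) (S N) (itil N).
  by near: N.
set X := cost c _.
have [N0 leX] : (0 < N)%N /\ c (itil N) N <= X.
  have [_ _ _ [g2N [n [reach _ niN]]]] := runN.
  have [/andP[ni_gt0 _] + _] := daub_reach_inv (itil N) hc hr hb g2N reach.
  by rewrite niN in ni_gt0 *.
have X0 : 0 <= X by exact: cost_ge runN.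
have cjX j : j \in suboptimal f N Delta -> c j N <= C * X.
  move=> jJ; have cjO : c j =O_\oo c (itil N).
    by move: j jJ; near: N.
  have le_bound : `|c j N| <= C * `|c (itil N) N|.
    by move: cjO; apply: (near bound N).
  rewrite !ger0_norm ?c_ge0 // in le_bound.
  by apply: le_trans le_bound _; rewrite ler_pM2l.
(* Dividing by [C] cancels the constant of [cjX], leaving at most one [X] for each of the [M]
   learners. *)
apply: (@le_trans _ _ (eps / C * \sum_(j in suboptimal f N Delta) c j N)).
  by near: N; apply: regret_small; rewrite divr_gt0.
rewrite ger0_norm ?mulr_ge0 // -mulrA ler_pM2l // ler_pdivrMl //.
apply: (@le_trans _ _ (\sum_(j < M) C * X)).
  rewrite big_mkcond ler_sum // => j _; case: ifP => [/cjX //|_].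
  by rewrite mulr_ge0 // ltW.
by rewrite sumr_const card_ord mulrCA mulr_natl.
Unshelve. all: by end_near. Qed.
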